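(* Let $A\in\mathbb{R}^{N\times N}$ and $M\in\mathbb{R}^{N\times N}$ be symmetric positive definite matrices, let $b, x_0\in\mathbb{R}^N$, let $\beta \ge \lambda_{\max}(MA)$ be an upper bound on the spectrum of $MA$, and let $k\ge 1$ be an integer. Consider the following algorithm: 1. Set $r = b - Ax_0$, $p = Mr$, $\mu = 1/3$, $d = 4\beta^{-1}$, and $x = x_0 + d\mu\, p$. 2. For $i = 2,\dots,k$, perform successively the updates $$r \gets b - Ax,\qquad p \gets \mu^2 p + Mr,\qquad \mu \gets (2-\mu)^{-1},\qquad x \gets x + d\mu\, p.$$ 3. Return $x$. Then the algorithm realizes the $M$-preconditioned polynomial iteration of degree $k$ based on the Chebyshev polynomials of the fourth kind; that is, if $x^\star = A^{-1}b$ and $x_k$ denotes the returned vector, then $$x^\star - x_k = \hat{W}_k(MA)\,(x^\star - x_0),\qquad \hat{W}_k(\zeta) = \frac{1}{2k+1}\, W_k\!\left(1 - \frac{2}{\beta}\zeta\right),$$ where $W_k$ is the $k$th-degree Chebyshev polynomial of the fourth kind.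
   Context: The Chebyshev polynomials of the fourth kind $W_n$ are defined by $W_0(t)=1$, $W_1(t)=2t+1$, and $W_{n+1}(t)=2t\,W_n(t)-W_{n-1}(t)$ for $n\ge 1$. A polynomial iteration for $Ax=b$ with preconditioner $M$ is an iterative method whose error $e_k = A^{-1}b - x_k$ satisfies $e_k = p_k(MA)e_0$ for some polynomial $p_k$ of degree $k$ with $p_k(0)=1$. $\lambda_{\max}(MA)$ denotes the largest eigenvalue of $MA$ (whose eigenvalues are real and positive). In the loop, updates are executed in the order listed, each using the current values of the variables. *)

(* Defs.v *)
From HB Require Import structures.
From mathcomp Require Import all_boot all_order all_algebra.
From mathcomp Require Import classical_sets reals.

Set Implicit Arguments.
Unset Strict Implicit.
Unset Printing Implicit Defensive.

Import Order.TTheory GRing.Theory Num.Theory.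
Local Open Scope ring_scope.

Definition spd (R : realType) (N : nat) (B : 'M[R]_N) : Prop :=
  B \is symmetricmx /\
  (forall v : 'cV[R]_N, v != 0 -> 0 < (v^T *m B *m v) 0 0).

(* The set of real eigenvalues is finite, so this supremum is the largest one
   whenever the set is nonempty (e.g., for a product of two SPD matrices of
   positive size); it is 0 for a matrix without real eigenvalues. *)
Definition lambda_max (R : realType) (N : nat) (B : 'M[R]_N) : R :=
  sup [set a : R | eigenvalue B a]%classic.

Fixpoint chebW (R : realType) (n : nat) : {poly R} :=
  match n with
  | 0%N => 1
  | 1%N => 2%:P * 'X + 1
  | (m.+1 as m1).+1 => 2%:P * 'X * chebW R m1 - chebW R m
  end.

Definition chebW_hat (R : realType) (beta : R) (k : nat) : {poly R} :=
  (2 * k%:R + 1)^-1 *: (chebW R k \Po (1 - (2 / beta) *: 'X)).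

Record state (R : realType) (N : nat) := State {
  st_r : 'cV[R]_N;
  st_p : 'cV[R]_N;
  st_mu : R;
  st_x : 'cV[R]_N }.

Definition cheb4_init (R : realType) (N : nat) (A M : 'M[R]_N)
    (b x0 : 'cV[R]_N) (beta : R) : state R N :=
  let r := b - A *m x0 in
  let p := M *m r in
  let mu := 1 / 3 in
  let d := 4 * beta^-1 in
  let x := x0 + (d * mu) *: p in
  State r p mu x.

Definition cheb4_step (R : realType) (N : nat) (A M : 'M[R]_N)
    (b : 'cV[R]_N) (beta : R) (s : state R N) : state R N :=
  let d := 4 * beta^-1 in
  let r := b - A *m st_x s in
  let p := st_mu s ^+ 2 *: st_p s + M *m r in
  let mu := (2 - st_mu s)^-1 in
  let x := st_x s + (d * mu) *: p in
  State r p mu x.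

(* The loop body runs for i = 2, ..., k, i.e., k - 1 times; meaningful for
   1 <= k. *)
Definition cheb4_iter (R : realType) (N : nat) (A M : 'M[R]_N)
    (b x0 : 'cV[R]_N) (beta : R) (k : nat) : 'cV[R]_N :=
  st_x (iter k.-1 (cheb4_step A M b beta) (cheb4_init A M b x0 beta)).

(* Main.v *)
Require Import Defs.
From HB Require Import structures.
From mathcomp Require Import all_boot all_order all_algebra.
From mathcomp Require Import classical_sets reals.
From mathcomp Require Import complex polyrcf.
From mathcomp Require Import ring lra.

Set Implicit Arguments.
Unset Strict Implicit.
Unset Printing Implicit Defensive.

Import Order.TTheory GRing.Theory Num.Theory.
Local Open Scope ring_scope.

(**
The error of the algorithm obeys the three-term recurrence of the scaled
fourth-kind Chebyshev polynomials; the momentum form of the update hides it.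
Write B = M A, e_j for the error after j steps, d = 4 / beta, and mu_j, p_j
for the values with which x_j was formed.  Then e_{j-1} - e_j = d mu_j p_j,
so eliminating p from two consecutive updates gives
  e_j - e_{j+1} = mu_{j+1} mu_j (e_{j-1} - e_j) + d mu_{j+1} B e_j.
The recurrence for mu started at 1/3 solves to mu_j = (2 j - 1) / (2 j + 1),
the quotient of the normalizing values W_{j-1}(1) and W_j(1).  Multiplying
by W_{j+1}(1) = 2 j + 3 turns the displayed identity into
W_{j+1}(t) = 2 t W_j(t) - W_{j-1}(t) at t = 1 - (2 / beta) B: this is
[chebW_hat_three_term], and [cheb4_iter_state] is the resulting induction.

The residual polynomial has degree exactly k because the substitution
1 - (2 / beta) X has degree one, that is, because beta is nonzero.  This
follows from 0 < lambda_max (M A) <= beta.  As [lambda_max] is a supremum, its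
positivity ([lambda_max_mul_spd_gt0]) requires that M A have a real
eigenvalue, that all of them be positive and that they be bounded.  A complex
eigenvalue exists over the algebraically closed field R[i], and it is real
because M A is self-adjoint for the inner product given by M
([selfadjoint_eigenvalue_exists]).
*)

Lemma chebWSS (R : realType) (m : nat) :
  chebW R m.+2 = 2%:P * 'X * chebW R m.+1 - chebW R m.
Proof. by []. Qed.

Lemma chebW_ind2 (P : nat -> Prop) :
  P 0%N -> P 1%N -> (forall m, P m -> P m.+1 -> P m.+2) -> forall m, P m.
Proof.
move=> P0 P1 PSS m; suff [] : P m /\ P m.+1 by [].
by elim: m => [|m [Pm PmS]]; split=> //; apply: PSS.
Qed.

Lemma size_chebW (R : realType) (m : nat) : size (chebW R m) = m.+1.
Proof.
elim/chebW_ind2: m => [||m IHm IHmS].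
- by rewrite /= size_poly1.
- by rewrite /= -polyC1 size_MXaddC polyC_eq0 pnatr_eq0 /= size_polyC pnatr_eq0.
have WS_neq0 : chebW R m.+1 != 0 by rewrite -size_poly_eq0 IHmS.
have sz_lead : size (2%:P * 'X * chebW R m.+1) = m.+3.
  by rewrite -mulrA mul_polyC size_scale ?pnatr_eq0 // mulrC size_mulX // IHmS.
by rewrite chebWSS size_polyDl ?size_polyN sz_lead // IHm.
Qed.

(** The value at 1 is the normalizing constant that makes the residual
polynomial equal to 1 at the origin. *)
Lemma chebW_at1 (R : realType) (m : nat) : (chebW R m).[1] = 2 * m%:R + 1.
Proof.
elim/chebW_ind2: m => [||m IHm IHmS].
- by rewrite hornerC mulr0 add0r.
- by rewrite /= !hornerE.
rewrite chebWSS !hornerE IHm IHmS -[m.+2%:R]natr1 -[m.+1%:R]natr1; ring.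
Qed.

Lemma odd_natr_neq0 (R : realType) (m : nat) : 2 * m%:R + 1 != 0 :> R.
Proof. by rewrite gt_eqF // ltr_wpDl ?mulr_ge0. Qed.

Lemma size_chebW_hat (R : realType) (beta : R) (m : nat) :
  beta != 0 -> size (chebW_hat beta m) = m.+1.
Proof.
move=> beta_neq0; rewrite size_scale; last first.
  by rewrite invr_eq0 odd_natr_neq0.
rewrite size_comp_poly2 ?size_chebW //.
have size_slope : size (- ((2 / beta) *: 'X)) = 2.
  by rewrite size_polyN size_scale ?size_polyX // mulf_neq0 ?invr_eq0 ?pnatr_eq0.
by rewrite addrC size_polyDl size_slope // size_poly1.
Qed.

Lemma chebW_hat_at0 (R : realType) (beta : R) (m : nat) :
  (chebW_hat beta m).[0] = 1.
Proof.
by rewrite hornerZ horner_comp !hornerE subr0 chebW_at1 mulVf ?odd_natr_neq0.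
Qed.

Lemma chebW_hat0 (R : realType) (beta : R) : chebW_hat beta 0 = 1.
Proof.
by rewrite /chebW_hat /= mulr0 add0r invr1 scale1r comp_polyC.
Qed.

Lemma chebW_hat1 (R : realType) (beta : R) :
  chebW_hat beta 1 = 1 - (4 / beta * (1 / 3)) *: 'X.
Proof.
rewrite /chebW_hat /= comp_polyD comp_polyM !comp_polyC comp_polyX mul_polyC.
apply/polyP=> i; rewrite !(coefD, coefZ, coefN) polyC1.
by move: beta^-1 => c; field.
Qed.

(** Closed form of the momentum coefficient of the algorithm after [m] passes
through the loop; the initialization is already the first step of the method,
so this is (2 j - 1) / (2 j + 1) with j = m + 1. *)
Definition cheb4_mu (R : realType) (m : nat) : R :=
  (2 * m%:R + 1) / (2 * m%:R + 3).

Lemma cheb4_mu0 (R : realType) : cheb4_mu R 0 = 1 / 3.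
Proof. by rewrite /cheb4_mu mulr0 !add0r. Qed.

Lemma cheb4_muS (R : realType) (m : nat) :
  cheb4_mu R m.+1 = (2 - cheb4_mu R m)^-1.
Proof.
have m_ge0 : 0 <= m%:R :> R by [].
rewrite /cheb4_mu -natr1; field.
by apply/andP; split; rewrite gt_eqF //; lra.
Qed.

(** The recurrence of W in the form that the algorithm computes: each step
difference combines the previous difference (momentum) with a residual term.
The coefficients of W_{m+1} and W_m agree after clearing the factors 2 m + 1,
2 m + 3 and 2 m + 5. *)
Lemma chebW_hat_three_term (R : realType) (beta : R) (m : nat) :
  chebW_hat beta m.+1 - chebW_hat beta m.+2 =
  (cheb4_mu R m.+1 * cheb4_mu R m) *: (chebW_hat beta m - chebW_hat beta m.+1)
  + (4 / beta * cheb4_mu R m.+1) *: ('X * chebW_hat beta m.+1).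
Proof.
have m_ge0 : 0 <= m%:R :> R by [].
rewrite /chebW_hat /cheb4_mu chebWSS comp_polyB !comp_polyM comp_polyC comp_polyX.
set P := chebW R m.+1 \Po _; set Q := chebW R m \Po _.
rewrite -mulrA mul_polyC mulrBl mul1r -scalerAl -scalerAr.
set XP := 'X * P.
apply/polyP=> i; rewrite !(coefD, coefZ, coefN) -[m.+2%:R]natr1 -[m.+1%:R]natr1.
move: beta^-1 P`_i Q`_i XP`_i (m%:R : R) m_ge0 => d x y z c c_ge0.
field.
by rewrite !gt_eqF //; lra.
Qed.

(** The loop invariant.  The last component makes the induction work: up to the
step length, the direction [p] is the difference of the last two errors, so the
momentum term supplies the older error of the three-term recurrence. *)
Lemma cheb4_iter_state (R : realType) (n : nat) (A M : 'M[R]_n.+1)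
    (b x0 xstar : 'cV[R]_n.+1) (beta : R) (m : nat) :
  A *m xstar = b ->
  let s := iter m (cheb4_step A M b beta) (cheb4_init A M b x0 beta) in
  let err j := horner_mx (M *m A) (chebW_hat beta j) *m (xstar - x0) in
  [/\ st_mu s = cheb4_mu R m,
      xstar - st_x s = err m.+1
    & (4 / beta * st_mu s) *: st_p s = err m - err m.+1].
Proof.
move=> defb; set B := M *m A; set e0 := xstar - x0 => s err.
have residual x : M *m (b - A *m x) = B *m (xstar - x).
  by rewrite -defb -mulmxBr mulmxA.
have errB i j : err i - err j =
    horner_mx B (chebW_hat beta i - chebW_hat beta j) *m e0.
  by rewrite rmorphB mulmxBl.
have horner_mxZ c q : horner_mx B (c *: q) = c *: horner_mx B q.
  by rewrite linearZ.
rewrite {}/s; elim: m => [|m [mu_m x_m p_m]].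
  have err0 : err 0 = e0 by rewrite /err chebW_hat0 rmorph1 mul1mx.
  have p_0 : (4 / beta * (1 / 3)) *: (M *m (b - A *m x0)) = err 0 - err 1.
    rewrite residual errB chebW_hat0 chebW_hat1 subKr.
    by rewrite linearZ /= horner_mx_X scalemxAl.
  split=> //=; first by rewrite cheb4_mu0.
  by rewrite opprD addrA p_0 err0 subKr.
rewrite iterS; set s := iter m _ _ in mu_m x_m p_m *.
have mu_mS : (2 - st_mu s)^-1 = cheb4_mu R m.+1 by rewrite mu_m cheb4_muS.
have p_mS : (4 / beta * (2 - st_mu s)^-1) *:
    (st_mu s ^+ 2 *: st_p s + M *m (b - A *m st_x s)) = err m.+1 - err m.+2.
  rewrite mu_mS residual x_m scalerDr errB chebW_hat_three_term.
  rewrite rmorphD /= mulmxDl !horner_mxZ [horner_mx B ('X * _)]rmorphM /= horner_mx_X.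
  rewrite -!scalemxAl -errB -p_m -[_ * _ *m e0]mulmxA !scalerA mu_m.
  by congr (_ *: _ + _); ring.
split=> //=.
by rewrite opprD addrA p_mS x_m subKr.
Qed.

Lemma spd_trmx (R : realType) (N : nat) (B : 'M[R]_N) : spd B -> B^T = B.
Proof.
case=> /is_hermitianmxP; rewrite expr0 scale1r => defB _.
by rewrite [RHS]defB map_mx_id.
Qed.

Lemma spd_row_gt0 (R : realType) (N : nat) (B : 'M[R]_N) (v : 'rV[R]_N) :
  spd B -> v != 0 -> 0 < (v *m B *m v^T) 0 0.
Proof.
move=> [_ posB] v_neq0; have := posB v^T; rewrite trmxK; apply.
by apply: contraNneq v_neq0 => /(congr1 trmx); rewrite trmxK trmx0 => ->.
Qed.

Lemma spd_unitmx (R : realType) (N : nat) (B : 'M[R]_N) :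
  spd B -> B \in unitmx.
Proof.
move=> spdB; rewrite unitmxE unitfE; apply/negP => /det0P[v v_neq0 vB0].
by have := spd_row_gt0 spdB v_neq0; rewrite vB0 mul0mx mxE ltxx.
Qed.

(** Right multiplication by a real matrix commutes with taking real and imaginary
parts, so these are the two parts of z v. *)
Lemma complex_eigenvector_parts (R : realType) (N : nat) (B : 'M[R]_N)
    (z : R[i]) (v : 'rV[R[i]]_N) :
    v *m map_mx (real_complex R) B = z *: v ->
  let u := map_mx (@complex.Re R) v in
  let w := map_mx (@complex.Im R) v in
  u *m B = complex.Re z *: u - complex.Im z *: w /\
  w *m B = complex.Im z *: u + complex.Re z *: w.
Proof.
move=> vB u w.
have ReD : {morph @complex.Re R : x y / x + y} by move=> [? ?] [? ?].
have ImD : {morph @complex.Im R : x y / x + y} by move=> [? ?] [? ?].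
split; apply/rowP=> j.
  have /(congr1 (@complex.Re R)) := congr1 (fun y : 'rV_N => y 0 j) vB.
  rewrite !mxE (big_morph _ ReD (erefl _)) => eq_j.
  transitivity (complex.Re (z * v 0 j)); last by case: z (v 0 j) {vB eq_j} => ? ? [].
  rewrite -eq_j; apply: eq_bigr => i _; rewrite !mxE.
  by case: (v 0 i) => x y /=; rewrite mulr0 subr0.
have /(congr1 (@complex.Im R)) := congr1 (fun y : 'rV_N => y 0 j) vB.
rewrite !mxE (big_morph _ ImD (erefl _)) => eq_j.
transitivity (complex.Im (z * v 0 j)); last first.
  by case: z (v 0 j) {vB eq_j} => ? ? [? ?] /=; rewrite addrC.
rewrite -eq_j; apply: eq_bigr => i _; rewrite !mxE.
by case: (v 0 i) => x y /=; rewrite mulr0 add0r.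
Qed.

(** The hypothesis says that [B] is self-adjoint for the inner product of row
vectors defined by [G].  If u + i w is an eigenvector for s + i t, comparing
the inner products of u B with w and of w B with u gives
t (|u|^2 + |w|^2) = 0, so the eigenvalue is real. *)
Lemma selfadjoint_eigenvalue_exists (R : realType) (n : nat)
    (B G : 'M[R]_n.+1) :
  spd G -> (B *m G)^T = B *m G -> exists a : R, eigenvalue B a.
Proof.
move=> spdG symBG.
have [z /eigenvalueP[v vB v_neq0]] :=
  Theorem7' (map_mx (real_complex R) B) (ltn0Sn n).
have := complex_eigenvector_parts vB.
set u := map_mx _ _; set w := map_mx _ _; set s := complex.Re z.
set t := complex.Im z => /= -[uB wB].
have uw_neq0 : (u != 0) || (w != 0).
  rewrite -negb_and; apply: contra v_neq0 => /andP[/eqP u0 /eqP w0].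
  apply/eqP/rowP => j.
  have := congr1 (fun y : 'rV_n.+1 => y 0 j) u0.
  have := congr1 (fun y : 'rV_n.+1 => y 0 j) w0.
  by rewrite !mxE; case: (v 0 j) => x y /= -> ->.
pose dot (x y : 'rV[R]_n.+1) := (x *m G *m y^T) 0 0.
have dot_ge0 x : 0 <= dot x x ?= iff (x == 0).
  split; last first.
    apply/eqP/eqP=> [x0|->]; last by rewrite /dot !mul0mx mxE.
    apply/eqP/negPn/negP => /(spd_row_gt0 spdG).
    by rewrite -/(dot x x) -x0 ltxx.
  have [->|/(spd_row_gt0 spdG)/ltW//] := eqVneq x 0.
  by rewrite /dot !mul0mx mxE.
have tr1 (m : 'M[R]_1) : m 0 0 = m^T 0 0 by rewrite mxE.
have dotC x y : dot x y = dot y x.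
  by rewrite /dot tr1 !trmx_mul trmxK (spd_trmx spdG) mulmxA.
have dotB x y : dot (x *m B) y = dot (y *m B) x.
  by rewrite /dot -!(mulmxA _ B) tr1 !trmx_mul trmxK -trmx_mul symBG !mulmxA.
have dotl a c x x' y : dot (a *: x + c *: x') y = a * dot x y + c * dot x' y.
  by rewrite /dot !mulmxDl -!scalemxAl !mxE.
have t0 : t = 0.
  have := dotB u w; rewrite uB wB -scaleNr !dotl (dotC w u) => eq_uw.
  have /eqP : t * (dot u u + dot w w) = 0 by lra.
  rewrite mulf_eq0 => /orP[/eqP //|].
  rewrite paddr_eq0 ?dot_ge0 //.
  rewrite ![dot _ _ == 0]eq_sym !dot_ge0 => /andP[u0 w0].
  by rewrite u0 w0 in uw_neq0.
exists s; apply/eigenvalueP.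
case/orP: uw_neq0 => [u_neq0|w_neq0].
  by exists u => //; rewrite uB t0 scale0r subr0.
by exists w => //; rewrite wB t0 scale0r add0r.
Qed.

(** Pairing v M A = a v with v M gives (v M) A (v M)^T = a (v M v^T), and both
quadratic forms are positive. *)
Lemma eigenvalue_mul_spd_gt0 (R : realType) (N : nat) (A M : 'M[R]_N) (a : R) :
  spd A -> spd M -> eigenvalue (M *m A) a -> 0 < a.
Proof.
move=> spdA spdM /eigenvalueP[v vMA v_neq0].
have vM_neq0 : v *m M != 0.
  apply: contraNneq v_neq0 => vM0; apply/eqP.
  by rewrite -(mulmxK (spd_unitmx spdM) v) vM0 mul0mx.
have := spd_row_gt0 spdA vM_neq0.
rewrite trmx_mul (spd_trmx spdM) -(mulmxA v) vMA -scalemxAl mulmxA mxE.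
by rewrite pmulr_lgt0 // spd_row_gt0.
Qed.

(** A supremum bounds its set only when the set is bounded above; here the
eigenvalues are the real roots of the characteristic polynomial, bounded by
its Cauchy bound. *)
Lemma eigenvalue_le_lambda_max (R : realType) (N : nat) (B : 'M[R]_N) (a : R) :
  eigenvalue B a -> a <= lambda_max B.
Proof.
move=> eig_a; apply: ub_le_sup => //.
exists (cauchy_bound (char_poly B)) => c /=.
rewrite eigenvalue_root_char => /rootP c_root.
apply: le_trans (ler_norm c) (ltW (cauchy_boundP _ c_root)).
exact: monic_neq0 (char_poly_monic B).
Qed.

Lemma lambda_max_mul_spd_gt0 (R : realType) (n : nat) (A M : 'M[R]_n.+1) :
  spd A -> spd M -> 0 < lambda_max (M *m A).
Proof.
move=> spdA spdM.
have [|a eig_a] := @selfadjoint_eigenvalue_exists R n (M *m A) M spdM.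
  by rewrite !trmx_mul (spd_trmx spdA) (spd_trmx spdM) mulmxA.
apply: lt_le_trans (eigenvalue_le_lambda_max eig_a).
exact: eigenvalue_mul_spd_gt0 eig_a.
Qed.

Theorem mainTheorem1 (R : realType) (n : nat) (A M : 'M[R]_n.+1)
    (b x0 : 'cV[R]_n.+1) (beta : R) (k : nat)
    (hA : spd A) (hM : spd M)
    (hbeta : lambda_max (M *m A) <= beta) (hk : (1 <= k)%N) :
  let xstar := invmx A *m b in
  let xk := cheb4_iter A M b x0 beta k in
  [/\ size (chebW_hat beta k) = k.+1,
      (chebW_hat beta k).[0] = 1
    & xstar - xk = horner_mx (M *m A) (chebW_hat beta k) *m (xstar - x0)].
Proof.
move=> xstar xk.
have beta_gt0 : 0 < beta := lt_le_trans (lambda_max_mul_spd_gt0 hA hM) hbeta.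
split; first by rewrite size_chebW_hat ?gt_eqF.
  exact: chebW_hat_at0.
have solA : A *m xstar = b by rewrite mulKVmx // spd_unitmx.
have [_] := cheb4_iter_state M x0 beta k.-1 solA.
by rewrite (prednK hk).
Qed.
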